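(* Let $\mathcal{U}$ be an ultrafilter on $\mathbb{N}=\{1,2,3,\dots\}$ along which $n$ tends to infinity (i.e. a non-principal ultrafilter), and let $G=\prod_{n\in\mathbb{N}}S_n\big/N_{\mathcal U}$ be the metric ultraproduct of the symmetric groups $S_n$ equipped with the normalized Hamming metric. Then $G$ does not satisfy any non-trivial mixed identity: for every $r\ge 1$ and every $w\in\mathbf{F}_r\ast G$ with $w\neq 1$, there are $g_1,\dots,g_r\in G$ with $w(g_1,\dots,g_r)\ne 1_G$.
   Context: The normalized Hamming metric on $S_n$ is $d_{\rm H}(\sigma,\tau)=\frac1n|\sigma^{-1}\tau|$, where $|\sigma|$ is the number of points of $\{1,\dots,n\}$ not fixed by $\sigma$; it is bi-invariant. For groups $G_n$ with bi-invariant metrics $d_n$ ($n\in\mathbb{N}$) and an ultrafilter $\mathcal{U}$ on $\mathbb{N}$, the metric ultraproduct is the quotient group $\prod_{n\in\mathbb{N}}G_n/N_{\mathcal U}$, where $N_{\mathcal U}=\{(g_n)_n : d_n(g_n,1_{G_n})\to_{\mathcal U}0\}$ is the normal subgroup of null sequences (convergence being along $\mathcal U$). $\mathbf{F}_r=\langle x_1,\dots,x_r\rangle$ is the free group on $x_1,\dots,x_r$ and $\ast$ is the free product. For $w\in\mathbf{F}_r\ast G$ and $g_1,\dots,g_r\in G$, $w(g_1,\dots,g_r)$ is the image of $w$ under the unique homomorphism $\mathbf{F}_r\ast G\to G$ that is the identity on $G$ and maps $x_i\mapsto g_i$. The word $w$ is a mixed identity for $G$ if $w(g_1,\dots,g_r)=1_G$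 for all $g_1,\dots,g_r\in G$; it is non-trivial if $w\ne 1$ in $\mathbf{F}_r\ast G$. *)

(* Defs.v *)
From HB Require Import structures.
From mathcomp Require Import all_boot all_order all_algebra all_fingroup.
From mathcomp Require Import all_classical all_reals all_analysis.
From mathcomp Require Import generic_quotient.
Import numFieldNormedType.Exports.
Import Order.TTheory GRing.Theory Num.Theory.

Set Implicit Arguments.
Unset Strict Implicit.
Unset Printing Implicit Defensive.

Local Open Scope classical_set_scope.
Local Open Scope quotient_scope.
Local Open Scope group_scope.

Inductive word_congr (A : Type) (rel : seq A -> seq A -> Prop) :
  seq A -> seq A -> Prop :=
| wc_step u v s t : rel s t -> word_congr rel (u ++ s ++ v) (u ++ t ++ v)
| wc_refl s : word_congr rel s s
| wc_sym s t : word_congr rel s t -> word_congr rel t s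
| wc_trans s t u :
    word_congr rel s t -> word_congr rel t u -> word_congr rel s u.

(* A monoid presentation in which each letter has an inverse letter, so that
   the monoid it presents is a group. *)
Record presentation := Presentation {
  letter : choiceType;
  relation : seq letter -> seq letter -> Prop;
  linv : letter -> letter;
  linvl : forall a, word_congr relation [:: linv a; a] [::];
  linvr : forall a, word_congr relation [:: a; linv a] [::] }.

Section Presented.
Variable P : presentation.
Local Notation W := (seq (letter P)).
Local Notation wc := (word_congr (@relation P)).

Definition wcb (s t : W) : bool := `[< wc s t >].

Lemma wcb_refl : reflexive wcb.
Proof. by move=> s; apply/asboolP; exact: wc_refl. Qed.

Lemma wcb_sym : symmetric wcb.
Proof. by move=> s t; apply/asboolP/asboolP; exact: wc_sym. Qed.

Lemma wcb_trans : transitive wcb.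
Proof.
move=> t s u /asboolP st /asboolP tu; apply/asboolP; exact: wc_trans st tu.
Qed.

Canonical wcb_equiv := EquivRel wcb wcb_refl wcb_sym wcb_trans.

Definition presented := {eq_quot wcb_equiv}.
HB.instance Definition _ := Choice.on presented.
HB.instance Definition _ := EqQuotient.on presented.

Definition word_class (s : W) : presented := \pi_presented s.

Lemma word_classP (s t : W) : word_class s = word_class t <-> wc s t.
Proof.
by split=> [/eqmodP/asboolP|st]; last by apply/eqmodP/asboolP.
Qed.

Lemma wc_repr (s : W) : wc (repr (word_class s)) s.
Proof. by apply/word_classP; rewrite /word_class reprK. Qed.

Lemma wc_ctx (u v s t : W) : wc s t -> wc (u ++ s ++ v) (u ++ t ++ v).
Proof.
elim=> [u' v' s' t' st|s'|s' t' _ IH|s' t' r' _ IH1 _ IH2].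
- have := wc_step (u ++ u') (v' ++ v) st.
  by rewrite -!catA.
- exact: wc_refl.
- exact: wc_sym.
- exact: wc_trans IH1 IH2.
Qed.

Lemma wc_cat (s s' t t' : W) : wc s s' -> wc t t' -> wc (s ++ t) (s' ++ t').
Proof.
move=> ss' tt'; apply: (wc_trans (t := s' ++ t)).
  exact: (wc_ctx [::] t ss').
by have := wc_ctx s' [::] tt'; rewrite !cats0.
Qed.

Definition winv (s : W) : W := rev (map (@linv P) s).

Lemma winvl (s : W) : wc (winv s ++ s) [::].
Proof.
elim: s => [|a s IH]; first exact: wc_refl.
rewrite /winv /= rev_cons cat_rcons.
apply: wc_trans IH.
exact: (wc_ctx (winv s) s (linvl a)).
Qed.

Lemma winvr (s : W) : wc (s ++ winv s) [::].
Proof.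
elim: s => [|a s IH]; first exact: wc_refl.
rewrite /winv /= rev_cons -cats1 catA.
apply: wc_trans (linvr a).
exact: (wc_ctx [:: a] [:: linv a] IH).
Qed.

Definition presented_one : presented := word_class [::].
Definition presented_mul (x y : presented) : presented :=
  word_class (repr x ++ repr y).
Definition presented_inv (x : presented) : presented :=
  word_class (winv (repr x)).

Lemma word_class_repr (x : presented) : word_class (repr x) = x.
Proof. exact: reprK. Qed.

Lemma presented_mulE (s t : W) :
  presented_mul (word_class s) (word_class t) = word_class (s ++ t).
Proof. by apply/word_classP/wc_cat; exact: wc_repr. Qed.

Lemma presented_mulA : associative presented_mul.
Proof.
move=> x y z; rewrite -[x]word_class_repr -[y]word_class_repr.
by rewrite -[z]word_class_repr !presented_mulE catA.
Qed.

Lemma presented_mul1 : left_id presented_one presented_mul.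
Proof. by move=> x; rewrite -[x]word_class_repr presented_mulE. Qed.

Lemma presented_mulr1 : right_id presented_one presented_mul.
Proof. by move=> x; rewrite -[x]word_class_repr presented_mulE cats0. Qed.

Lemma presented_mulV : left_inverse presented_one presented_inv presented_mul.
Proof.
move=> x; rewrite -[X in presented_mul _ X]word_class_repr presented_mulE.
by apply/word_classP/winvl.
Qed.

Lemma presented_mulrV : right_inverse presented_one presented_inv presented_mul.
Proof.
move=> x; rewrite -[X in presented_mul X _]word_class_repr presented_mulE.
by apply/word_classP/winvr.
Qed.

HB.instance Definition _ := isGroup.Build presented
  presented_mulA presented_mul1 presented_mulr1 presented_mulV presented_mulrV.

Lemma word_classM (s t : W) : word_class (s ++ t) = word_class s * word_class t.
Proof. by rewrite -presented_mulE. Qed.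

Lemma word_class1 : word_class [::] = 1. Proof. by []. Qed.

Lemma word_class_prod (s : W) :
  word_class s = \prod_(a <- s) word_class [:: a].
Proof.
elim: s => [|a s IH]; first by rewrite big_nil.
by rewrite big_cons -IH -word_classM.
Qed.

Section Lift.
Variables (K : groupType) (f : letter P -> K).
Hypothesis f_rel :
  forall s t, relation s t -> \prod_(a <- s) f a = \prod_(a <- t) f a.

Definition pres_lift (x : presented) : K := \prod_(a <- repr x) f a.

Lemma pres_prod_congr (s t : W) :
  wc s t -> \prod_(a <- s) f a = \prod_(a <- t) f a.
Proof.
elim=> // [u v s' t' /f_rel E|s' t' u _ -> _ ->] //.
by rewrite !big_cat /= E.
Qed.

Lemma pres_liftE (s : W) : pres_lift (word_class s) = \prod_(a <- s) f a.
Proof. exact/pres_prod_congr/wc_repr. Qed.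

Lemma pres_liftM : {morph pres_lift : x y / x * y}.
Proof.
move=> x y; rewrite -[x]word_class_repr -[y]word_class_repr -word_classM.
by rewrite !pres_liftE big_cat.
Qed.

End Lift.
End Presented.

(* (x, true) stands for the generator x and (x, false) for its inverse. *)
Inductive free_relation (X : Type) :
  seq (X * bool) -> seq (X * bool) -> Prop :=
| free_cancel x b : free_relation [:: (x, b); (x, ~~ b)] [::].

Section FreeGroup.
Variable X : choiceType.

Definition free_linv (a : X * bool) : X * bool := (a.1, ~~ a.2).

Lemma free_linvr a :
  word_congr (@free_relation X) [:: a; free_linv a] [::].
Proof.
case: a => x b; apply: (@wc_step _ _ [::] [::] [:: _; _] [::]).
exact: free_cancel.
Qed.

Lemma free_linvl a :
  word_congr (@free_relation X) [:: free_linv a; a] [::].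
Proof.
by have := free_linvr (free_linv a); case: a => x b; rewrite /free_linv negbK.
Qed.

Definition free_presentation : presentation :=
  @Presentation (X * bool)%type (@free_relation X) free_linv
    free_linvl free_linvr.

Definition free_group : groupType := presented free_presentation.

Definition free_gen (x : X) : free_group :=
  @word_class free_presentation [:: (x, true)].

Section Lift.
Variables (K : groupType) (g : X -> K).

Definition free_lift_letter (a : X * bool) : K :=
  if a.2 then g a.1 else (g a.1)^-1.

Definition free_lift (w : free_group) : K :=
  @pres_lift free_presentation K free_lift_letter w.

Lemma free_lift_rel s t : free_relation s t ->
  \prod_(a <- s) free_lift_letter a = \prod_(a <- t) free_lift_letter a.
Proof.
case=> x b; rewrite !big_cons !big_nil mulg1.
by case: b; rewrite /free_lift_letter /= ?mulgV ?mulVg.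
Qed.

Lemma free_liftM : {morph free_lift : x y / x * y}.
Proof. exact: (@pres_liftM free_presentation _ _ free_lift_rel). Qed.

HB.instance Definition _ :=
  isMultiplicative.Build free_group K free_lift free_liftM.

Lemma free_lift_gen x : free_lift (free_gen x) = g x.
Proof.
by rewrite /free_lift (@pres_liftE free_presentation _ _ free_lift_rel)
   big_seq1.
Qed.

End Lift.
End FreeGroup.

Inductive freeprod_relation (G H : groupType) :
  seq (G + H) -> seq (G + H) -> Prop :=
| fp_one_l : freeprod_relation [:: inl 1] [::]
| fp_one_r : freeprod_relation [:: inr 1] [::]
| fp_mul_l a b : freeprod_relation [:: inl a; inl b] [:: inl (a * b)]
| fp_mul_r a b : freeprod_relation [:: inr a; inr b] [:: inr (a * b)].

Lemma multiplicative1 (G H : groupType) (f : {multiplicative G -> H}) : f 1 = 1.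
Proof. by apply: (mulgI (f 1)); rewrite -gmulfM !mulg1. Qed.

Lemma multiplicativeV (G H : groupType) (f : {multiplicative G -> H}) x :
  f x^-1 = (f x)^-1.
Proof.
by apply: (mulgI (f x)); rewrite -gmulfM !mulgV multiplicative1.
Qed.

Section FreeProduct.
Variables G H : groupType.

Definition freeprod_linv (a : G + H) : G + H :=
  match a with inl x => inl x^-1 | inr y => inr y^-1 end.

Let rel_congr s t : @freeprod_relation G H s t ->
  word_congr (@freeprod_relation G H) s t.
Proof. by move=> /(@wc_step _ _ [::] [::]); rewrite !cats0. Qed.

Lemma freeprod_linvl a :
  word_congr (@freeprod_relation G H) [:: freeprod_linv a; a] [::].
Proof.
case: a => x /=.
- apply: wc_trans (rel_congr (fp_mul_l _ _ _)) _; rewrite mulVg.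
  exact: rel_congr (fp_one_l _ _).
- apply: wc_trans (rel_congr (fp_mul_r _ _ _)) _; rewrite mulVg.
  exact: rel_congr (fp_one_r _ _).
Qed.

Lemma freeprod_linvr a :
  word_congr (@freeprod_relation G H) [:: a; freeprod_linv a] [::].
Proof.
by have := freeprod_linvl (freeprod_linv a); case: a => x /=; rewrite invgK.
Qed.

Definition freeprod_presentation : presentation :=
  @Presentation (G + H)%type (@freeprod_relation G H) freeprod_linv
    freeprod_linvl freeprod_linvr.

Definition free_product : groupType := presented freeprod_presentation.

Definition fp_inl (x : G) : free_product :=
  @word_class freeprod_presentation [:: inl x].
Definition fp_inr (y : H) : free_product :=
  @word_class freeprod_presentation [:: inr y].

Lemma fp_inlM : {morph fp_inl : x y / x * y}.
Proof.
move=> x y; rewrite /fp_inl -word_classM; apply/word_classP/wc_sym.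
exact: rel_congr (fp_mul_l _ _ _).
Qed.

Lemma fp_inrM : {morph fp_inr : x y / x * y}.
Proof.
move=> x y; rewrite /fp_inr -word_classM; apply/word_classP/wc_sym.
exact: rel_congr (fp_mul_r _ _ _).
Qed.

HB.instance Definition _ := isMultiplicative.Build G free_product fp_inl fp_inlM.
HB.instance Definition _ := isMultiplicative.Build H free_product fp_inr fp_inrM.

Section Lift.
Variables (K : groupType).
Variables (f : {multiplicative G -> K}) (h : {multiplicative H -> K}).

Definition freeprod_lift_letter (a : G + H) : K :=
  match a with inl x => f x | inr y => h y end.

Definition freeprod_lift (w : free_product) : K :=
  @pres_lift freeprod_presentation K freeprod_lift_letter w.

Lemma freeprod_lift_rel s t : freeprod_relation s t ->
  \prod_(a <- s) freeprod_lift_letter a =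
  \prod_(a <- t) freeprod_lift_letter a.
Proof.
by case=> [||a b|a b]; rewrite !big_cons !big_nil !mulg1 /= ?gmulfM
  ?multiplicative1.
Qed.

Lemma freeprod_liftM : {morph freeprod_lift : x y / x * y}.
Proof. exact: (@pres_liftM freeprod_presentation _ _ freeprod_lift_rel). Qed.

HB.instance Definition _ :=
  isMultiplicative.Build free_product K freeprod_lift freeprod_liftM.

Lemma freeprod_lift_inl x : freeprod_lift (fp_inl x) = f x.
Proof.
by rewrite /freeprod_lift
   (@pres_liftE freeprod_presentation _ _ freeprod_lift_rel) big_seq1.
Qed.

Lemma freeprod_lift_inr y : freeprod_lift (fp_inr y) = h y.
Proof.
by rewrite /freeprod_lift
   (@pres_liftE freeprod_presentation _ _ freeprod_lift_rel) big_seq1.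
Qed.

End Lift.
End FreeProduct.

Definition mixed_word (r : nat) (G : groupType) : groupType :=
  free_product (free_group 'I_r) G.

Section MixedWord.
Variables (r : nat) (G : groupType).

Definition mixed_eval (w : mixed_word r G) (g : 'I_r -> G) : G :=
  freeprod_lift (free_lift g) (@idfun G) w.

Lemma mixed_evalM (g : 'I_r -> G) : {morph mixed_eval^~ g : v w / v * w}.
Proof. exact: freeprod_liftM. Qed.

Lemma mixed_eval_var (g : 'I_r -> G) i :
  mixed_eval (fp_inl G (free_gen i)) g = g i.
Proof. by rewrite /mixed_eval freeprod_lift_inl /= free_lift_gen. Qed.

Lemma mixed_eval_const (g : 'I_r -> G) c :
  mixed_eval (fp_inr (free_group 'I_r) c) g = c.
Proof. by rewrite /mixed_eval freeprod_lift_inr. Qed.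

Lemma mixed_eval_unique (g : 'I_r -> G)
    (f : {multiplicative mixed_word r G -> G}) :
  (forall i, f (fp_inl G (free_gen i)) = g i) ->
  (forall c, f (fp_inr (free_group 'I_r) c) = c) ->
  forall w, f w = mixed_eval w g.
Proof.
move=> fx fc w.
have liftE v : f (fp_inl G v) = mixed_eval (fp_inl G v) g.
  rewrite -[v]word_class_repr.
  elim: (repr v) => [|[i b] s IH].
    rewrite word_class1.
    by rewrite multiplicative1 /mixed_eval !multiplicative1.
  rewrite -cat1s word_classM gmulfM [LHS]gmulfM mixed_evalM IH; congr (_ * _).
  case: b; first by rewrite fx mixed_eval_var.
  have -> : @word_class (free_presentation 'I_r) [:: (i, false)]
            = (free_gen i)^-1.
    apply: (mulIg (free_gen i)); rewrite mulVg -word_classM.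
    by apply/word_classP; exact: (free_linvl (i, true)).
  have evV x : mixed_eval x^-1 g = (mixed_eval x g)^-1.
    by rewrite /mixed_eval multiplicativeV.
  by rewrite multiplicativeV evV [LHS]multiplicativeV fx mixed_eval_var.
rewrite -[w]word_class_repr; elim: (repr w) => [|a s IH].
  by rewrite word_class1 multiplicative1 /mixed_eval multiplicative1.
rewrite -cat1s word_classM [LHS]gmulfM mixed_evalM IH; congr (_ * _).
by case: a => [v|c]; [exact: liftE | rewrite [LHS]fc [RHS]mixed_eval_const].
Qed.

End MixedWord.

Record normal_subgroup (G : groupType) := NormalSubgroup {
  nsg_set : set G;
  nsg1 : nsg_set 1;
  nsgM : forall x y, nsg_set x -> nsg_set y -> nsg_set (x * y);
  nsgV : forall x, nsg_set x -> nsg_set x^-1;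
  nsgJ : forall x y, nsg_set x -> nsg_set (y^-1 * x * y) }.

Section QuotientGroup.
Variables (G : groupType) (N : normal_subgroup G).

Definition nsg_rel (x y : G) : bool := `[< nsg_set N (x^-1 * y) >].

Lemma nsg_rel_refl : reflexive nsg_rel.
Proof. by move=> x; apply/asboolP; rewrite mulVg; exact: nsg1. Qed.

Lemma nsg_rel_sym : symmetric nsg_rel.
Proof.
by move=> x y; apply/asboolP/asboolP => /nsgV; rewrite invgM invgK.
Qed.

Lemma nsg_rel_trans : transitive nsg_rel.
Proof.
move=> y x z /asboolP xy /asboolP yz; apply/asboolP.
by have := nsgM xy yz; rewrite -mulgA mulKVg.
Qed.

Canonical nsg_equiv :=
  EquivRel nsg_rel nsg_rel_refl nsg_rel_sym nsg_rel_trans.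

Definition quotient_group := {eq_quot nsg_equiv}.
HB.instance Definition _ := Choice.on quotient_group.
HB.instance Definition _ := EqQuotient.on quotient_group.

Definition quotient_class (x : G) : quotient_group := \pi_quotient_group x.

Lemma quotient_classP (x y : G) :
  quotient_class x = quotient_class y <-> nsg_set N (x^-1 * y).
Proof. by split=> [/eqmodP/asboolP|xy]; last by apply/eqmodP/asboolP. Qed.

Lemma quotient_class_repr (x : quotient_group) : quotient_class (repr x) = x.
Proof. exact: reprK. Qed.

Lemma nsg_repr (x : G) : nsg_set N ((repr (quotient_class x))^-1 * x).
Proof. by apply/quotient_classP; rewrite quotient_class_repr. Qed.

Definition quotient_one : quotient_group := quotient_class 1.
Definition quotient_mul (x y : quotient_group) : quotient_group :=
  quotient_class (repr x * repr y).
Definition quotient_inv (x : quotient_group) : quotient_group :=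
  quotient_class (repr x)^-1.

Lemma quotient_mulE (x y : G) :
  quotient_mul (quotient_class x) (quotient_class y) = quotient_class (x * y).
Proof.
apply/quotient_classP; rewrite invgM.
set x' := repr (quotient_class x); set y' := repr (quotient_class y).
have := nsgM (nsgJ y' (nsg_repr x)) (nsg_repr y).
by rewrite -/x' -/y' -!mulgA mulKVg.
Qed.

Lemma quotient_mulA : associative quotient_mul.
Proof.
move=> x y z; rewrite -[x]quotient_class_repr -[y]quotient_class_repr.
by rewrite -[z]quotient_class_repr !quotient_mulE mulgA.
Qed.

Lemma quotient_mul1 : left_id quotient_one quotient_mul.
Proof. by move=> x; rewrite -[x]quotient_class_repr quotient_mulE mul1g. Qed.

Lemma quotient_mulr1 : right_id quotient_one quotient_mul.
Proof. by move=> x; rewrite -[x]quotient_class_repr quotient_mulE mulg1. Qed.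

Lemma quotient_mulV : left_inverse quotient_one quotient_inv quotient_mul.
Proof.
move=> x; rewrite -[X in quotient_mul _ X]quotient_class_repr quotient_mulE.
by rewrite mulVg.
Qed.

Lemma quotient_mulrV : right_inverse quotient_one quotient_inv quotient_mul.
Proof.
move=> x; rewrite -[X in quotient_mul X _]quotient_class_repr quotient_mulE.
by rewrite mulgV.
Qed.

HB.instance Definition _ := isGroup.Build quotient_group
  quotient_mulA quotient_mul1 quotient_mulr1 quotient_mulV quotient_mulrV.

Lemma quotient_classM : {morph quotient_class : x y / x * y}.
Proof. by move=> x y; rewrite -quotient_mulE. Qed.

HB.instance Definition _ :=
  isMultiplicative.Build G quotient_group quotient_class quotient_classM.

End QuotientGroup.

Definition prod_group (I : Type) (G : I -> groupType) := forall i, G i.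

Section ProdGroup.
Variables (I : Type) (G : I -> groupType).

HB.instance Definition _ := gen_eqMixin (prod_group G).
HB.instance Definition _ := gen_choiceMixin (prod_group G).

Definition prod_one : prod_group G := fun i => 1.
Definition prod_mul (x y : prod_group G) : prod_group G := fun i => x i * y i.
Definition prod_inv (x : prod_group G) : prod_group G := fun i => (x i)^-1.

Lemma prod_mulA : associative prod_mul.
Proof. by move=> x y z; apply: functional_extensionality_dep => i; exact: mulgA. Qed.

Lemma prod_mul1 : left_id prod_one prod_mul.
Proof. by move=> x; apply: functional_extensionality_dep => i; exact: mul1g. Qed.

Lemma prod_mulr1 : right_id prod_one prod_mul.
Proof. by move=> x; apply: functional_extensionality_dep => i; exact: mulg1. Qed.

Lemma prod_mulV : left_inverse prod_one prod_inv prod_mul.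
Proof. by move=> x; apply: functional_extensionality_dep => i; exact: mulVg. Qed.

Lemma prod_mulrV : right_inverse prod_one prod_inv prod_mul.
Proof. by move=> x; apply: functional_extensionality_dep => i; exact: mulgV. Qed.

HB.instance Definition _ := isGroup.Build (prod_group G)
  prod_mulA prod_mul1 prod_mulr1 prod_mulV prod_mulrV.

End ProdGroup.

Record biinvariant_metric (R : realType) (G : groupType) := BiinvariantMetric {
  bim :> G -> G -> R;
  bim_eq0 : forall x y, bim x y = 0%R <-> x = y;
  bim_sym : forall x y, bim x y = bim y x;
  bim_triangle : forall x y z, (bim x z <= bim x y + bim y z)%R;
  bim_mull : forall g x y, bim (g * x) (g * y) = bim x y;
  bim_mulr : forall g x y, bim (x * g) (y * g) = bim x y }.

Lemma bim_ge0 (R : realType) (G : groupType) (d : biinvariant_metric R G) x y :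
  (0 <= d x y)%R.
Proof.
have := bim_triangle d x y x.
by rewrite (bim_eq0 d x x).2 // (bim_sym d y) -mulr2n pmulrn_lge0.
Qed.

Section MetricUltraproduct.
Variables (R : realType) (I : Type) (U : set_system I).
Context {UU : UltraFilter U}.
Variables (G : I -> groupType) (d : forall i, biinvariant_metric R (G i)).
Local Open Scope ring_scope.

Definition null_sequence : set (prod_group G) :=
  [set g | d i (g i) 1%g @[i --> U] --> (0 : R)].

Lemma null_sequence1 : null_sequence 1%g.
Proof.
rewrite /null_sequence /=.
under eq_fun do rewrite (bim_eq0 (d _) _ _).2//.
exact: cvg_cst.
Qed.

Lemma null_sequenceM x y :
  null_sequence x -> null_sequence y -> null_sequence (x * y)%g.
Proof.
move=> x0 y0; rewrite /null_sequence /=.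
apply: (@squeeze_cvgr _ _ _ _ (fun=> 0)
  (fun i => d i (x i) 1%g + d i (y i) 1%g)).
- apply: nearW => i; rewrite bim_ge0 /=.
  apply: le_trans (bim_triangle (d i) _ (y i) _) _.
  rewrite lerD2r -[X in d i _ X]mul1g.
  by rewrite (bim_mulr (d i) (y i) (x i) 1%g).
- exact: cvg_cst.
- by rewrite -[X in _ --> X]addr0; exact: cvgD.
Qed.

Lemma null_sequenceV x : null_sequence x -> null_sequence x^-1%g.
Proof.
rewrite /null_sequence /=.
suff -> : (fun i => d i (x^-1%g i) 1%g) = (fun i => d i (x i) 1%g) by [].
apply: funext => i.
by rewrite -(bim_mull (d i) (x i)) mulgV mulg1 bim_sym.
Qed.

Lemma null_sequenceJ x y : null_sequence x -> null_sequence (y^-1 * x * y)%g.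
Proof.
rewrite /null_sequence /=.
suff -> : (fun i => d i ((y^-1 * x * y : prod_group G)%g i) 1%g) = (fun i => d i (x i) 1%g)
  by [].
apply: funext => i.
rewrite -(bim_mull (d i) (y i)) -(bim_mulr (d i) (y i)^-1%g).
rewrite (_ : y i * _ * _ = x i)%g ?mulg1 ?mulgV //.
by rewrite -[X in (y i * X)%g]/((y i)^-1 * x i * y i)%g !mulgA mulgV mul1g mulgK.
Qed.

Definition null_subgroup : normal_subgroup (prod_group G) :=
  NormalSubgroup null_sequence1 null_sequenceM null_sequenceV null_sequenceJ.

Definition metric_ultraproduct : groupType := quotient_group null_subgroup.

End MetricUltraproduct.
Arguments metric_ultraproduct {R I} U {UU G} d.

Section Hamming.
Variables (R : realType) (n : nat).
Local Open Scope ring_scope.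

Definition moved_points (s : 'S_n) : nat := #|[pred x | s x != x]|.

(* MathComp composes permutations from left to right; by bi-invariance the
   metric does not depend on this convention. *)
Definition hamming_dist (s t : 'S_n) : R :=
  n%:R^-1 * (moved_points (s^-1 * t)%g)%:R.

Lemma moved_pointsE (s t : 'S_n) :
  moved_points (s^-1 * t)%g = #|[pred x | s x != t x]|.
Proof.
rewrite /moved_points -(fintype.card_image (@perm_inj _ s) [pred x | s x != t x]).
apply: eq_card => x; rewrite inE /=; apply/idP/fintype.imageP.
- move=> sx; exists (s^-1%g x); rewrite ?inE /= ?permKV //.
  by rewrite eq_sym -permM.
- by case=> y; rewrite inE /= => yt ->; rewrite permM permK eq_sym.
Qed.

Lemma hamming_eq0 s t : hamming_dist s t = 0 <-> s = t.
Proof.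
rewrite /hamming_dist moved_pointsE; split=> [/eqP|->]; last first.
  by rewrite eq_card0 ?mulr0 // => x; rewrite !inE eqxx.
rewrite mulf_eq0 invr_eq0 !pnatr_eq0 => E.
apply/permP => x; apply/eqP; move: E; case/orP=> [/eqP n0|/eqP/card0_eq/(_ x)].
  by have := leq_ltn_trans (leq0n x) (ltn_ord x); rewrite [X in (_ < X)%N]n0.
by rewrite inE /= => /negbFE.
Qed.

Lemma hamming_sym s t : hamming_dist s t = hamming_dist t s.
Proof.
rewrite /hamming_dist !moved_pointsE; congr (_ * _%:R).
by apply: eq_card => x; rewrite !inE eq_sym.
Qed.

Lemma hamming_triangle s t u :
  hamming_dist s u <= hamming_dist s t + hamming_dist t u.
Proof.
rewrite /hamming_dist -mulrDr ler_wpM2l ?invr_ge0 ?ler0n// -natrD ler_nat.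
rewrite !moved_pointsE -cardUI; apply: leq_trans (leq_addr _ _).
apply/subset_leq_card/fintype.subsetP => x; rewrite !inE /=.
by apply: contraNT; rewrite negb_or !negbK => /andP[/eqP-> /eqP->].
Qed.

Lemma hamming_mull g s t :
  hamming_dist (g * s)%g (g * t)%g = hamming_dist s t.
Proof. by rewrite /hamming_dist invgM -mulgA mulKg. Qed.

Lemma hamming_mulr g s t :
  hamming_dist (s * g)%g (t * g)%g = hamming_dist s t.
Proof.
rewrite /hamming_dist !moved_pointsE; congr (_ * _%:R).
by apply: eq_card => x; rewrite !inE !permM (inj_eq perm_inj).
Qed.

Definition hamming_metric : biinvariant_metric R 'S_n :=
  BiinvariantMetric hamming_eq0 hamming_sym hamming_triangle
    hamming_mull hamming_mulr.

End Hamming.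

(* The index n : nat stands for the positive integer n.+1, so that the index
   set is {1, 2, 3, ...}. *)
Definition symmetric_ultraproduct (R : realType) (U : set_system nat)
    {UU : UltraFilter U} : groupType :=
  metric_ultraproduct U (fun n : nat => hamming_metric R n.+1).
Arguments symmetric_ultraproduct R U {UU}.

(* Main.v *)
(* Write w = c_0 x_{l_1} c_1 ... x_{l_k} c_k with c_j <> 1 whenever l_{j+1} is
   the inverse letter of l_j, and lift the constants to sequences of
   permutations; along U, the relevant c_j move at least e n points of
   {1, ..., n}.  Permutations substituted for the variables are then built
   greedily: follow a point p through w, choosing each image under a variable
   so that it and its image under the next constant avoid the edges prescribed
   so far; if the next letter undoes the current one, the next constant must
   also move the chosen image, which is possible as it moves many points.  The
   last image can be chosen so that w moves p.  Each p costs k edges, so this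
   can be repeated for about e n / 4k points p, and the values of w stay at a
   Hamming distance from 1 that is bounded below. *)

Require Import Defs.
From HB Require Import structures.
From mathcomp Require Import all_boot all_order all_algebra all_fingroup.
From mathcomp Require Import all_classical all_reals all_analysis.
From mathcomp Require Import zify.
Import numFieldNormedType.Exports.
Import Order.TTheory GRing.Theory Num.Theory.

(** * Words as alternating lists of letters and constants *)

Section Words.
Local Open Scope group_scope.
Context {X : choiceType}.

(** Each entry of [s] pairs a letter with the constant after it. The group [K] is left open because
    the same expression is read in the free product, in the ultraproduct, in the product of the
    symmetric groups and in each of them. *)
Definition word_eval {K : groupType} (g : X -> K) (c0 : K)
    (s : seq (X * bool * K)) : K :=
  c0 * \prod_(a <- s) (free_lift_letter g a.1 * a.2).

Definition map_coeffs {H K : Type} (f : H -> K) (s : seq (X * bool * H)) :=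
  [seq (a.1, f a.2) | a <- s].

(** [P] is demanded only of a constant between a letter and its inverse: non-triviality in the
    ultraproduct, moving many points in a symmetric group. *)
Definition reducing {K : Type} (P : pred K) : rel (X * bool * K) :=
  fun a b => (b.1 == free_linv a.1) ==> P a.2.

Lemma morph_word_eval {H K : groupType} (f : {multiplicative H -> K})
    (g : X -> H) c0 s :
  f (word_eval g c0 s) = word_eval (f \o g) (f c0) (map_coeffs f s).
Proof.
rewrite /word_eval gmulfM; congr (_ * _).
elim: s => [|[[i b] c] s IH]; first by rewrite !big_nil multiplicative1.
rewrite !big_cons !gmulfM IH; congr (_ * _ * _).
by case: b; rewrite //= /free_lift_letter /= multiplicativeV.
Qed.

Lemma word_eval_cons {K : groupType} (g : X -> K) c0 a s :
  word_eval g c0 (a :: s) =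
  c0 * free_lift_letter g a.1 * word_eval g a.2 s.
Proof. by rewrite /word_eval big_cons !mulgA. Qed.

Lemma free_lift_letter_linv {K : groupType} (g : X -> K) l :
  free_lift_letter g (free_linv l) = (free_lift_letter g l)^-1.
Proof. by case: l => i []; rewrite /free_lift_letter /= ?invgK. Qed.

Lemma free_linvK : involutive (@free_linv X).
Proof. by case=> i b; rewrite /free_linv /= negbK. Qed.

Lemma word_class_letter (l : X * bool) :
  @word_class (free_presentation X) [:: l] = free_lift_letter (@free_gen X) l.
Proof.
case: l => i [] //; apply: (mulIg (free_gen i)).
rewrite /free_lift_letter /= mulVg -word_classM.
by apply/word_classP; exact: (free_linvl (i, true)).
Qed.

End Words.

Lemma word_class_surj {P : presentation} (x : presented P) :
  exists s, x = word_class s.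
Proof. by eexists; exact: esym (word_class_repr x). Qed.

(** * Reduced forms in the free product *)

Section NormalForm.
Local Open Scope group_scope.
Context {r : nat} {G : groupType}.
Local Notation F := (free_group 'I_r).
Local Notation inF := (@fp_inl F G).
Local Notation inG := (@fp_inr F G).

(** Reduced forms are stable under left multiplication by constants and by letters, and these
    generate the free product. *)
Lemma mixed_word_reduced (w : mixed_word r G) : exists c0 s,
  sorted (reducing (fun c : G => c != 1)) s /\
  w = word_eval (inF \o @free_gen 'I_r) (inG c0) (map_coeffs inG s).
Proof.
set x := inF \o _; pose good (v : mixed_word r G) := exists c0 s,
  sorted (reducing (fun c : G => c != 1)) s /\
  v = word_eval x (inG c0) (map_coeffs inG s).
have good_inr c v : good v -> good (inG c * v).
  case=> c0 [s [red ->]]; exists (c * c0), s; split=> //.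
  by rewrite /word_eval gmulfM mulgA.
have good_letter l v : good v -> good (free_lift_letter x l * v).
  case=> c0 [s [red ->]].
  have extend : sorted (reducing (fun c : G => c != 1)) ((l, c0) :: s) ->
      good (free_lift_letter x l * word_eval x (inG c0) (map_coeffs inG s)).
    move=> red'; exists 1, ((l, c0) :: s); split=> //.
    by rewrite multiplicative1 word_eval_cons mul1g.
  case: s red extend => [|[l' c'] s] red extend; first exact: extend.
  (* Prepending [l] breaks reducedness only if [l'] is its inverse and [c0] is trivial; then the two
     letters cancel and a reduced tail remains. *)
  have [/andP[/eqP/= l'E /eqP c01]|nred] :=
      boolP ((l' == free_linv l) && (c0 == 1)); last first.
    by apply/extend/andP; split; first by rewrite /reducing /= implybE -negb_and.
  exists c', s; split; first exact: path_sorted red.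
  rewrite c01 multiplicative1 word_eval_cons /= l'E free_lift_letter_linv.
  by rewrite mul1g mulKVg.
have good_inl u v : good v -> good (inF u * v).
  have [s -> gv] := word_class_surj u; elim: s => [|l s IH].
    by rewrite word_class1 multiplicative1 mul1g.
  have lE : inF (word_class (P := free_presentation 'I_r) [:: l]) =
      free_lift_letter x l.
    rewrite word_class_letter; case: l => i [] //.
    by rewrite /free_lift_letter /= multiplicativeV.
  rewrite -cat1s word_classM gmulfM -mulgA [X in X * _]lE.
  exact: good_letter.
have good1 : good 1.
  exists 1, [::]; split=> //.
  by rewrite multiplicative1 /word_eval big_nil mulg1.
have [s ->] := word_class_surj w; elim: s => [|[u|c] s IH] //.
- by rewrite -cat1s word_classM; exact: (good_inl u).
- by rewrite -cat1s word_classM; exact: (good_inr c).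
Qed.

End NormalForm.

(** * Greedy choice of permutations on a finite set *)

Section PermutationWords.
Set Implicit Arguments.
Unset Strict Implicit.
Local Open Scope group_scope.
Context {X T : finType}.
Implicit Types (sigma tau : X -> {perm T}) (l : X * bool) (D : {set X * bool * T}).

Definition step sigma l : {perm T} := free_lift_letter sigma l.

Lemma step_linvK sigma l : cancel (step sigma l) (step sigma (free_linv l)).
Proof. by move=> p; rewrite /step free_lift_letter_linv permK. Qed.

(* [(l, p)] stands for the edge from [p] to [step sigma l p] traversed from [p];
   both traversals of an edge must be present. *)
Definition edge_set sigma D :=
  forall l p, (l, p) \in D -> (free_linv l, step sigma l p) \in D.

Definition agree D sigma tau :=
  forall l p, (l, p) \in D -> step tau l p = step sigma l p.

(** Sends [a] to [b], and the old preimage of [b] to the old image of [a]; all other images are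
    kept. *)
Definition redirect sigma (i : X) (a b : T) : X -> {perm T} :=
  fun j => if j == i then sigma i * tperm (sigma i a) b else sigma j.

(** Only the images of [a] and of the old preimage of [b] change. As [D] holds both traversals of
    its edges, the two non-membership hypotheses say that no edge of [D] for [i] leaves [a] or
    enters [b]. *)
Lemma redirect_agree sigma D i a b : edge_set sigma D ->
  (i, true, a) \notin D -> (i, false, b) \notin D ->
  agree D sigma (redirect sigma i a b).
Proof.
move=> closedD aD bD [j c] p jpD.
rewrite /step /free_lift_letter /redirect /=; have [ji|//] := eqVneq j i.
have := closedD _ _ jpD; rewrite /step /free_lift_letter /free_linv /=.
subst j; case: c jpD => /= pD spD.
  rewrite permM tpermD //.
    by apply: contraNneq aD => /perm_inj ->.
  by apply: contraNneq bD => ->.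
rewrite invMg tpermV permM tpermD //.
  by apply: contraNneq aD => E; rewrite -E permK in spD.
by apply: contraNneq bD => ->.
Qed.

Lemma extend_edge sigma D l p q : edge_set sigma D ->
  (l, p) \notin D -> (free_linv l, q) \notin D ->
  exists tau, [/\ agree D sigma tau, step tau l p = q &
    edge_set tau (D :|: [set (l, p); (free_linv l, q)])].
Proof.
move=> closedD pD qD.
suff [tau [Dtau tauE]] : exists tau, agree D sigma tau /\ step tau l p = q.
  exists tau; split=> // l' p'; rewrite !inE => /or3P[p'D|/eqP[-> ->]|/eqP[-> ->]].
  - by rewrite Dtau // closedD.
  - by rewrite tauE eqxx !orbT.
  - by rewrite -tauE step_linvK free_linvK eqxx orbT.
case: l pD qD => i [] pD qD.
  exists (redirect sigma i p q); split; first exact: redirect_agree.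
  by rewrite /step /free_lift_letter /redirect /= eqxx permM tpermL.
exists (redirect sigma i q p); split; first exact: redirect_agree.
rewrite /step /free_lift_letter /redirect /= eqxx.
by apply: (@perm_inj _ (sigma i * tperm (sigma i q) p));
  rewrite permKV permM tpermL.
Qed.

Lemma agree_trans D D' sigma tau rho : D \subset D' ->
  agree D sigma tau -> agree D' tau rho -> agree D sigma rho.
Proof.
move=> /fintype.subsetP DD' st tr l p lpD; rewrite -st // tr //; exact: DD'.
Qed.

Definition moved (c : {perm T}) := #|[pred p | c p != p]|.

Lemma exists_notin (A : {set T}) : (#|A| < #|T|)%N -> exists p, p \notin A.
Proof.
move=> cA; have /set0Pn[p] : ~: A != finset.set0.
  by rewrite -card_gt0 cardsCs finset.setCK subn_gt0.
by rewrite inE => ?; exists p.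
Qed.

Lemma card_fiber l D : #|[set p | (l, p) \in D]| <= #|D|.
Proof.
rewrite -(@card_imset _ _ (pair l)); last by move=> p q [].
by apply/subset_leq_card/fintype.subsetP => _ /imsetP[p + ->]; rewrite inE.
Qed.

(* The conclusion is for all [rho] agreeing with [tau] on [D'], so that it
   survives the later modifications of [tau]. *)
Lemma extend_path m (hm : m <= #|T|) l c s sigma D p p0 :
  edge_set sigma D -> (l, p) \notin D ->
  path (reducing (fun c => m <= moved c)) (l, c) s ->
  (2 * (#|D| + 2 * size s) + 1 < m)%N ->
  exists tau D', [/\ D \subset D', agree D sigma tau, edge_set tau D',
    (#|D'| <= #|D| + 2 * (size s).+1)%N &
    forall rho, agree D' tau rho ->
      word_eval rho 1 ((l, c) :: s) p != p0].
Proof.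
elim: s l c sigma D p => [|[l' c'] s IH] l c sigma D p closedD pD red small.
  (* At the last letter, avoiding [c^-1 p0] is what keeps the whole word from sending [p] to
     [p0]. *)
  have [|q] := @exists_notin ([set q | (free_linv l, q) \in D] :|: [set c^-1 p0]).
    rewrite (leq_ltn_trans (leq_card_setU _ _)) // cards1.
    have := card_fiber (free_linv l) D; move: small hm => /=; lia.
  rewrite !inE negb_or => /andP[qD cq].
  have [tau [Dtau tauE closed']] := extend_edge closedD pD qD.
  exists tau, (D :|: [set (l, p); (free_linv l, q)]); split=> //.
  - exact: finset.subsetUl.
  - rewrite (leq_trans (leq_card_setU _ _)) // leq_add2l cards2.
    by case: (_ != _).
  - move=> rho rhoD; rewrite word_eval_cons /word_eval big_nil mulg1 mul1g permM.
    rewrite -/(step rho l) rhoD ?inE ?eqxx ?orbT // tauE /=.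
    by apply: contra cq => /eqP <-; rewrite permK.
move: red => /= /andP[red_l red].
(* The edge leaving [c q] by [l'] must not be the reverse of the edge just
   added, so [c] has to move [q] if [l'] is the inverse of [l]. *)
pose stay := if l' == free_linv l then [set q | c q == q] else finset.set0.
have card_stay : #|stay| + m <= #|T|.
  rewrite /stay; move: red_l; rewrite /reducing /=; case: eqP => [_ /= mc|_ _].
    rewrite -(cardsC [set q | c q == q]) leq_add2l (leq_trans mc) //.
    by rewrite /moved; apply/subset_leq_card/fintype.subsetP => q; rewrite !inE.
  by rewrite cards0.
(* Excluding [c q = p] keeps the next edge from being the new edge [(l, p)] itself. At most
   [2 * #|D| + 1 + #|stay|] points are forbidden, fewer than [m + #|stay|]. *)
have [|q] := @exists_notin ([set q | (free_linv l, q) \in D] :|: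
    c @^-1: ([set q | (l', q) \in D] :|: [set p]) :|: stay).
  have cardp : #|c @^-1: ([set q | (l', q) \in D] :|: [set p])| <= #|D| + 1.
    rewrite card_preimset; last exact: perm_inj.
    rewrite (leq_trans (leq_card_setU _ _)) // cards1 leq_add2r.
    exact: card_fiber.
  apply: leq_ltn_trans (leq_card_setU _ _) _.
  apply: leq_ltn_trans (leq_add (leq_card_setU _ _) (leqnn _)) _.
  apply: leq_ltn_trans (leq_add (leq_add (card_fiber _ _) cardp) (leqnn _)) _.
  move: small card_stay => /=; move: #|D| #|stay| #|T| => d e N; lia.
rewrite !inE !negb_or => /andP[/andP[qD /andP[cqD cqp]] qstay].
have [sigma1 [Dsigma1 sigma1E closed1]] := extend_edge closedD pD qD.
set D1 := D :|: _ in closed1.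
have cardD1 : #|D1| <= #|D| + 2.
  rewrite (leq_trans (leq_card_setU _ _)) // leq_add2l cards2.
  by case: (_ != _).
have [|||tau [D' [D1D' agree1 closed' cardD' neq]]] :=
    IH l' c' sigma1 D1 (c q) closed1.
- rewrite !inE !negb_or cqD /= !xpair_eqE negb_and cqp orbT /=.
  move: qstay; rewrite /stay; case: eqP => //= _.
  by rewrite inE.
- exact: red.
- move: small cardD1 => /=; lia.
exists tau, D'; split=> //.
- exact: fintype.subset_trans (finset.subsetUl _ _) D1D'.
- exact: agree_trans (finset.subsetUl _ _) Dsigma1 agree1.
- move: cardD' cardD1 => /=; lia.
- move=> rho rhoD; rewrite word_eval_cons mul1g permM.
  have -> : free_lift_letter rho l p = q.
    have /(_ l p) := agree_trans D1D' agree1 rhoD.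
    by rewrite /step sigma1E /D1 !inE eqxx orbT => ->.
  have := neq rho rhoD.
  by rewrite /word_eval mul1g /= permM.
Qed.

Lemma word_eval_moved m c0 a s :
  m <= #|T| -> sorted (reducing (fun c => m <= moved c)) (a :: s) ->
  exists sigma : X -> {perm T},
    (m <= 4 * (size s).+1 * (moved (word_eval sigma c0 (a :: s)) + 1)%N)%N.
Proof.
move=> hm red; set k := (size s).+1.
(* Each point adds at most [2 * k] elements to [D], two traversals for each of [k] edges. With
   [#|D| <= 2 * k * (t - 1)], the room that [extend_path] needs for the [t]-th point is exactly
   [4 * k * t < m + 3]. *)
have build t : (4 * k * t < m + 3)%N -> exists sigma D (S : {set T}),
    [/\ edge_set sigma D, (#|D| <= 2 * k * t)%N, #|S| = t &
    forall p, p \in S -> forall rho, agree D sigma rho ->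
      word_eval rho c0 (a :: s) p != p].
  elim: t => [_|t IH small].
    exists (fun=> 1), finset.set0, finset.set0.
    by split=> [l p| | |p]; rewrite ?inE ?cards0.
  have [|sigma [D [S [closedD cardD cardS neq]]]] := IH; first by lia.
  have [|p] := @exists_notin (S :|: c0 @^-1: [set p | (a.1, p) \in D]).
    rewrite (leq_ltn_trans (leq_card_setU _ _)) //.
    rewrite card_preimset; last exact: perm_inj.
    rewrite cardS (leq_ltn_trans (leq_add (leqnn t) (card_fiber _ _))) //.
    have := leq_pmull t (ltn0Sn (size s)); rewrite -/k.
    by move: hm cardD small; move: #|D| #|T| => d N; rewrite /k; nia.
  rewrite !inE negb_or => /andP[pS pD].
  (* The path starts at [c0 p] and must not end at [p]. *)
  have [||tau [D' [DD' Dtau closed' cardD' neq']]] :=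
    @extend_path m hm a.1 a.2 s sigma D (c0 p) p closedD pD.
  - by move: red; case: (a).
  - move: small cardD; rewrite /k; nia.
  exists tau, D', (p |: S); split=> //.
  - rewrite (leq_trans cardD') // -/k; move: cardD; lia.
  - by rewrite cardsU1 pS cardS.
  move=> p'; rewrite !inE => /orP[/eqP->|p'S] rho agr.
    by have := neq' _ agr; rewrite !word_eval_cons /= mul1g !permM.
  apply: neq => //; exact: agree_trans DD' Dtau agr.
(* The largest [t] that [build] allows; the rounding is absorbed by the [+ 1] next to [moved]. *)
have [|sigma [D [S [_ _ cardS neq]]]] := build ((m + 2) %/ (4 * k))%N.
  have := leq_divM (m + 2) (4 * k)%N; rewrite /k; nia.
exists sigma; have : #|S| <= moved (word_eval sigma c0 (a :: s)).
  by apply/subset_leq_card/fintype.subsetP => p /neq; rewrite inE; exact.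
rewrite cardS; move: (moved _) => M.
have := ltn_ceil (m + 2) (isT : (0 < 4 * k)%N).
move: (_ %/ _)%N => Q; rewrite /k; nia.
Qed.

(** The threshold [y] is rounded down to an integer, which costs the outer [+ 1]. *)
Lemma word_eval_moved_real {R : realType} (y : R) c0 a s :
  (0 <= y <= #|T|%:R)%R ->
  sorted (reducing (fun c => y <= (moved c)%:R)%R) (a :: s) ->
  exists sigma : X -> {perm T},
    (y <= (4 * (size s).+1 * (moved (word_eval sigma c0 (a :: s)) + 1) + 1)%:R)%R.
Proof.
move=> /andP[y0 yT] red.
have trunc_y : ((Num.truncn y)%:R <= y)%R by rewrite truncn_le.
have [||sigma le_sigma] := @word_eval_moved (Num.truncn y) c0 a s.
- by rewrite -(ler_nat R) (le_trans trunc_y).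
- apply: sub_sorted red => b b' /implyP red_b; apply/implyP => /red_b.
  by rewrite -(ler_nat R); exact: le_trans.
exists sigma; apply/ltW/(lt_le_trans (truncnS_gt _)).
by rewrite ler_nat -addn1 leq_add2r.
Qed.

End PermutationWords.

(** Named so that evaluation at [i] can be declared a homomorphism and moved through words by
    [morph_word_eval]. *)
Definition prod_proj {I : Type} (G : I -> groupType) (i : I)
  (x : prod_group G) : G i := x i.

HB.instance Definition _ (I : Type) (G : I -> groupType) (i : I) :=
  isMultiplicative.Build (prod_group G) (G i) (@prod_proj I G i)
    (fun _ _ => erefl).

Lemma mixed_eval_word_eval {r : nat} {G : groupType} (g : 'I_r -> G) c0 s :
  mixed_eval (word_eval (@fp_inl (free_group 'I_r) G \o @free_gen 'I_r)
    (@fp_inr (free_group 'I_r) G c0)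
    (map_coeffs (@fp_inr (free_group 'I_r) G) s)) g = word_eval g c0 s.
Proof.
rewrite /mixed_eval morph_word_eval /= freeprod_lift_inr /=; congr word_eval.
  by apply: funext => i /=; rewrite freeprod_lift_inl /= free_lift_gen.
rewrite /map_coeffs -map_comp -[RHS]map_id.
by apply: eq_map => -[l c] /=; rewrite freeprod_lift_inr.
Qed.

Lemma hamming_dist1 {R : realType} {n} (s : 'S_n) :
  hamming_dist R s 1 = (n%:R^-1 * (moved s)%:R)%R.
Proof.
rewrite /hamming_dist moved_pointsE; congr (_ * _%:R)%R.
by apply: eq_card => p; rewrite !inE perm1.
Qed.

Local Open Scope classical_set_scope.

(** * Lifted constants along the ultrafilter *)

Section Ultraproduct.
Context {R : realType} {U : set_system nat} {UU : UltraFilter U}.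
Local Open Scope ring_scope.
Local Notation G := (symmetric_ultraproduct R U).
Local Notation P := (prod_group (fun n : nat => 'S_n.+1 : groupType)).
Local Notation Nl := (null_subgroup (U := U) (fun n : nat => hamming_metric R n.+1)).
Local Notation cls := (@Defs.quotient_class _ Nl).

Lemma cls_eq1 (x : P) : cls x = 1%g <->
  ((moved (x n))%:R / n.+1%:R : R) @[n --> U] --> (0 : R).
Proof.
have -> : (fun n => (moved (x n))%:R / n.+1%:R : R) =
    (fun n => hamming_dist R (x n) 1%g).
  by apply: funext => n; rewrite hamming_dist1 mulrC.
split=> [/esym/Defs.quotient_classP|xN]; first by rewrite invg1 mul1g.
by apply/esym/Defs.quotient_classP; rewrite invg1 mul1g.
Qed.

(** An ultrafilter contains each set or its complement: if the bound failed for every [e], the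
    reverse bounds would hold along [U] and make [x] a null sequence. *)
Lemma cls_neq1_near (x : P) : cls x != 1%g ->
  exists2 e : R, 0 < e & \forall n \near U, e * n.+1%:R <= (moved (x n))%:R.
Proof.
move=> x1; apply: contrapT => noe; move/eqP: x1; apply; apply/cls_eq1.
apply/cvgr0Pnorm_lt => e e0.
have [xU|] := in_ultra_setVsetC [set n | e * n.+1%:R <= (moved (x n))%:R :> R] UU.
  by case: noe; exists e.
apply: filterS => n /= /negP; rewrite -ltNge => lt.
by rewrite ger0_norm ?divr_ge0 // ltr_pdivrMr.
Qed.

(** Finitely many constants allow a common [e], by taking minima. The bound [e <= 1] keeps
    [e * n.+1%:R] at most the number of points, as [word_eval_moved_real] requires. *)
Lemma coeffs_near (lift : G -> P) (s : seq G) : cancel lift cls ->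
  exists2 e : R, 0 < e <= 1 & \forall n \near U, forall c, c \in s -> c != 1%g ->
    e * n.+1%:R <= (moved (lift c n))%:R.
Proof.
move=> liftK; elim: s => [|c s [e /andP[e0 e1] es]].
  by exists 1; [rewrite ltr01 lexx | apply: nearW].
have [->|c1] := eqVneq c 1%g.
  exists e; first by rewrite e0.
  apply: filterS es => n es c'; rewrite inE => /predU1P[->|]; last exact: es.
  by rewrite eqxx.
have [|e' e'0 e'c] := @cls_neq1_near (lift c); first by rewrite liftK.
exists (Num.min e e'); first by rewrite lt_min e0 e'0 ge_min e1.
near=> n => c'; rewrite inE => /predU1P[->|c's] c'1.
  apply: le_trans (near e'c n _) => //.
  by rewrite ler_wpM2r // ge_min lexx orbT.
apply: le_trans (near es n _ c' c's c'1) => //.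
by rewrite ler_wpM2r // ge_min lexx.
Unshelve. all: by end_near. Qed.

End Ultraproduct.

Theorem corollary2 (R : realType) (U : set_system nat) (UU : UltraFilter U)
    (U_oo : U --> \oo) (r : nat) (r_ge1 : (1 <= r)%N)
    (w : mixed_word r (symmetric_ultraproduct R U)) (w_neq1 : w <> 1%g) :
  exists g : 'I_r -> symmetric_ultraproduct R U, mixed_eval w g <> 1%g.
Proof.
have [c0 [s [red wE]]] := mixed_word_reduced w.
have evalE g : mixed_eval w g = word_eval g c0 s.
  by rewrite wE mixed_eval_word_eval.
case: s red wE evalE => [|a s] red wE evalE.
  (* Without letters, [w] is the constant [c0], which is non-trivial as [w] is. *)
  exists (fun=> 1%g); rewrite evalE /word_eval big_nil mulg1 => c01.
  by apply: w_neq1; rewrite wE c01 /word_eval big_nil mulg1 multiplicative1.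
set G := symmetric_ultraproduct R U in c0 a s red wE evalE *.
pose cls := @Defs.quotient_class _ (null_subgroup (UU := UU)
  (fun n : nat => hamming_metric R n.+1)).
have [lift liftK] : exists lift, cancel lift cls.
  have /choice[f fP] : forall x : G, exists y, cls y = x.
    by move=> x; eexists; exact: Defs.quotient_class_repr.
  by exists f.
have [e /andP[e0 e1] e_near] := @coeffs_near R U UU lift
  [seq b.2 | b <- a :: s] liftK.
pose k := (size s).+1.
pose proj n c : 'S_n.+1 := lift c n.
(* The implication makes [tau] available at every index; where some constant moves too few points,
   trivial permutations serve as a default. *)
have tau_ex n : exists tau : 'I_r -> 'S_n.+1,
    (forall c, c \in [seq b.2 | b <- a :: s] -> c != 1%g ->
      e * n.+1%:R <= (moved (proj n c))%:R)%R ->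
    (e * n.+1%:R <= (4 * k * (moved (word_eval tau (proj n c0)
      (map_coeffs (proj n) (a :: s))) + 1) + 1)%:R)%R.
  have [big|] := pselect (forall c, c \in [seq b.2 | b <- a :: s] -> c != 1%g ->
      e * n.+1%:R <= (moved (proj n c))%:R)%R; last by exists (fun=> 1%g).
  have [||tau le_tau] := @word_eval_moved_real 'I_r 'I_n.+1 R (e * n.+1%:R)%R
      (proj n c0) (a.1, proj n a.2) (map_coeffs (proj n) s).
  - by rewrite mulr_ge0 ?(ltW e0) //= card_ord ler_piMl.
  - rewrite -[_ :: _]/(map_coeffs (proj n) (a :: s)) /map_coeffs sorted_map.
    apply: (sub_in_sorted (P := mem (a :: s))) red; last exact/allP.
    move=> b b' bs _ /implyP red_b; apply/implyP => /= /red_b b1.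
    by apply: big => //; exact: map_f.
  by exists tau; rewrite size_map in le_tau.
pose tau n := projT1 (cid (tau_ex n)).
pose gamma (i : 'I_r) : prod_group (fun n : nat => 'S_n.+1 : groupType) :=
  fun n => tau n i.
exists (cls \o gamma); rewrite evalE.
have -> : word_eval (cls \o gamma) c0 (a :: s) =
    cls (word_eval gamma (lift c0) (map_coeffs lift (a :: s))).
  apply: esym; apply: etrans (morph_word_eval cls gamma _ _) _.
  congr word_eval; first exact: liftK.
  rewrite /map_coeffs -map_comp -[RHS]map_id.
  by apply: eq_map => -[l c]; congr pair; exact: liftK.
move=> /cls_eq1 /cvgr0Pnorm_lt small.
have k0 : (0 < (4 * k)%:R :> R)%R by rewrite ltr0n.
(* With [M] the number of points moved at index [n], [tau_ex] bounds [e * n.+1%:R] by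
   [4 * k * M + (4 * k + 1)]. This [eps] makes the first term less than half of [e * n.+1%:R], and a
   large [n] does the same for the second. *)
have eps0 : (0 < e / 2 / (4 * k)%:R)%R by rewrite !divr_gt0.
have large : \forall n \near U, ((4 * k + 1)%:R < e / 2 * n.+1%:R)%R.
  apply: U_oo.
  near=> n.
  rewrite -ltr_pdivrMl ?divr_gt0 //.
  have /lt_trans : (((e / 2)^-1 * (4 * k + 1)%:R) < n%:R)%R.
    near: n; exact: nbhs_infty_gtr.
  by apply; rewrite ltr_nat.
have [n [[n_small n_large] n_e]] :=
  filter_ex (filterI (filterI (small _ eps0) large) e_near).
have := projT2 (cid (tau_ex n)) n_e; apply/negP; rewrite -ltNge.
set M := moved _.
move: n_small; rewrite -/(prod_proj n _) morph_word_eval.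
have -> : map_coeffs (prod_proj n) (map_coeffs lift (a :: s)) =
    map_coeffs (proj n) (a :: s) by rewrite /map_coeffs -map_comp.
rewrite -/(tau n) ger0_norm ?divr_ge0 // ltr_pdivrMr //.
move=> n_small; have M_lt : (M%:R < e / 2 / (4 * k)%:R * n.+1%:R)%R := n_small.
have -> : (4 * k * (M + 1) + 1 = M * (4 * k) + (4 * k + 1))%N by lia.
rewrite natrD natrM [ltRHS](_ : _ = e / 2 * n.+1%:R + e / 2 * n.+1%:R)%R; last first.
  by rewrite -mulrDl -splitr.
by rewrite ltrD // -ltr_pdivlMr // mulrAC.
Unshelve. all: by end_near. Qed.
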